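(* The set $\{x\approx\neg x\Rightarrow\emptyset\}$ is a basis for the admissible clauses of De Morgan lattices, and the set $\{x\approx\neg x\Rightarrow x\approx y\}$ is a basis for the admissible quasi-identities of De Morgan lattices.
   Context: A De Morgan lattice is an algebra $(A,\wedge,\vee,\neg)$ such that $(A,\wedge,\vee)$ is a distributive lattice, $\neg\neg a=a$ and $\neg(a\wedge b)=\neg a\vee\neg b$ for all $a,b\in A$ (no constants for bounds in the language). All algebras are non-empty. A clause $\Sigma\Rightarrow\Delta$ (with $\Sigma,\Delta$ finite, possibly empty, sets of identities) is satisfied by an algebra if every assignment of the variables making all identities in $\Sigma$ true makes at least one identity in $\Delta$ true (so $\Sigma\Rightarrow\emptyset$ means that no assignment makes all of $\Sigma$ true). It is a quasi-identity if $|\Delta|=1$. A universal class (resp. quasivariety) is the class of all algebras of the language satisfying some set of clauses (resp. quasi-identities); $\mathbb{U}(\mathcal{K})$ and $\mathbb{Q}(\mathcal{K})$ are the smallest universal class and smallest quasivariety containing $\mathcal{K}$. For a quasivariety $\mathcal{Q}$, $\mathbf{F}_{\mathcal{Q}}$ is its free algebra on countably infinitely many generators. A set $\Lambda$ of clauses (resp. quasi-identities) is a basis for the admissible clauses (resp. quasi-identities) of $\mathcal{Q}$ if for every algebra $\mathbf{A}$: $\mathbf{A}\in\mathbb{U}(\mathbf{F}_{\mathcal{Q}})$ (resp. $\mathbf{A}\in\mathbb{Q}(\mathbf{F}_{\mathcal{Q}})$) iff $\mathbf{A}\in\mathcal{Q}$ and $\mathbf{A}$ satisfies all members of $\Lambda$.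 *)

(* Defs.v *)
From HB Require Import structures.
From mathcomp Require Import all_boot finmap.
From mathcomp Require Import boolp.

Set Implicit Arguments.
Unset Strict Implicit.
Unset Printing Implicit Defensive.

Local Open Scope fset_scope.
Local Open Scope quotient_scope.

(* Algebras of the language (/\, \/, ~) of type (2, 2, 1). *)
Record algebra := Algebra {
  carrier :> Type;
  meet : carrier -> carrier -> carrier;
  join : carrier -> carrier -> carrier;
  neg : carrier -> carrier;
  carrier_nonempty : inhabited carrier
}.

Definition distributive_lattice (T : Type) (m j : T -> T -> T) : Prop :=
  [/\ commutative m /\ commutative j,
      associative m /\ associative j,
      (forall x y, m x (j x y) = x) /\ (forall x y, j x (m x y) = x)
    & left_distributive m j].

Definition de_morgan_lattice (A : algebra) : Prop :=
  [/\ distributive_lattice (@meet A) (@join A),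
      involutive (@neg A)
    & forall a b : A, neg (meet a b) = join (neg a) (neg b)].

Inductive term :=
  | Var of nat
  | Meet of term & term
  | Join of term & term
  | Neg of term.

HB.instance Definition _ := gen_eqMixin term.
HB.instance Definition _ := gen_choiceMixin term.

Fixpoint eval (A : algebra) (v : nat -> A) (t : term) : A :=
  match t with
  | Var n => v n
  | Meet s u => meet (eval v s) (eval v u)
  | Join s u => join (eval v s) (eval v u)
  | Neg s => neg (eval v s)
  end.

Notation identity := (term * term)%type.

Definition holds (A : algebra) (v : nat -> A) (e : identity) : Prop :=
  eval v e.1 = eval v e.2.

Record clause := Clause {
  premises : {fset identity};
  conclusions : {fset identity}
}.

Definition satisfies (A : algebra) (c : clause) : Prop :=
  forall v : nat -> A,
    (forall e, e \in premises c -> holds v e) ->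
    exists2 e, e \in conclusions c & holds v e.

Definition quasi_identity (c : clause) : Prop := #|` conclusions c| = 1%N.

Definition universal_class (C : algebra -> Prop) : Prop :=
  exists L : clause -> Prop,
    forall A, C A <-> (forall c, L c -> satisfies A c).

Definition quasivariety (C : algebra -> Prop) : Prop :=
  exists L : clause -> Prop,
    (forall c, L c -> quasi_identity c) /\
    forall A, C A <-> (forall c, L c -> satisfies A c).

Definition universal_closure (K : algebra -> Prop) (A : algebra) : Prop :=
  forall C, universal_class C -> (forall B, K B -> C B) -> C A.

Definition quasivariety_closure (K : algebra -> Prop) (A : algebra) : Prop :=
  forall C, quasivariety C -> (forall B, K B -> C B) -> C A.

(* The free algebra of Q on the generators Var 0, Var 1, ... is the algebra of *)
(* terms modulo the identities valid in Q. This relation is a congruence, so   *)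
(* computing on representatives below gives the quotient operations.           *)
Definition valid_in (Q : algebra -> Prop) (s t : term) : bool :=
  `[< forall A, Q A -> forall v : nat -> A, eval v s = eval v t >].

Lemma valid_in_equiv Q : equiv_class_of (valid_in Q).
Proof.
split=> [s|s t|t s u].
- exact/asboolP.
- by apply/asboolP/asboolP => H A QA v; rewrite H.
- by move=> /asboolP H1 /asboolP H2; apply/asboolP => A QA v; rewrite H1 ?H2.
Qed.

Canonical valid_in_rel Q := EquivRelPack (valid_in_equiv Q).

Definition free_algebra (Q : algebra -> Prop) : algebra :=
  let T := {eq_quot (valid_in_rel Q)} in
  @Algebra T
    (fun x y => \pi_T (Meet (repr x) (repr y)))
    (fun x y => \pi_T (Join (repr x) (repr y)))
    (fun x => \pi_T (Neg (repr x)))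
    (inhabits (\pi_T (Var 0))).

Definition admissible_clause_basis (Q : algebra -> Prop)
    (L : clause -> Prop) : Prop :=
  forall A : algebra,
    universal_closure (eq (free_algebra Q)) A <->
    Q A /\ (forall c, L c -> satisfies A c).

Definition admissible_quasi_identity_basis (Q : algebra -> Prop)
    (L : clause -> Prop) : Prop :=
  (forall c, L c -> quasi_identity c) /\
  forall A : algebra,
    quasivariety_closure (eq (free_algebra Q)) A <->
    Q A /\ (forall c, L c -> satisfies A c).

(* Main.v *)
(* A point of a De Morgan lattice is a lattice homomorphism to {0, 1}, possibly
   constant; points separate elements, and h |-> (x |-> ~ h(~ x)) is an involution
   on them. If A has no fixed point x = ~x, some point p0 of A is fixed by this
   involution, i.e. is a homomorphism onto the Boolean lattice. Given finitely
   many points h_e of A, closed under the involution, pick an antichain of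
   points c_e, in the middle layer of the cube of points of a finitely generated
   free algebra, on which the involution acts in the same way. The map on points
   sending c_e to h_e, everything else above (below) some c_e to the constant
   point 1 (0), and all remaining points to p0 is monotone and commutes with the
   involution, so it is dual to a homomorphism from A to the free algebra that
   separates whatever the h_e separate. Choosing the h_e to refute the conclusions
   of a clause that fails in A refutes the clause in the free algebra. A lattice
   satisfying x = ~x => x = y is trivial or has no fixed point. *)
From mathcomp Require Import boolp classical_sets.
Require Import Defs.
From mathcomp Require Import all_boot finmap.

Set Implicit Arguments.
Unset Strict Implicit.
Unset Printing Implicit Defensive.

Local Open Scope fset_scope.
Local Open Scope quotient_scope.

(** * Lattice order, points and prime filters *)

Definition le (A : algebra) (x y : A) : Prop := meet x y = x.

Lemma le_refl (A : algebra) (x : A) : de_morgan_lattice A -> le x x.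
Proof.
by case=> -[_ _ [mK jK] _] _ _; rewrite /le -[RHS](mK x (meet x x)) jK.
Qed.

Lemma le_trans (A : algebra) (x y z : A) :
  de_morgan_lattice A -> le x y -> le y z -> le x z.
Proof.
by case=> -[_ [mA _] _ _] _ _ xy yz; rewrite /le -[in LHS]xy -mA yz.
Qed.

Lemma le_anti (A : algebra) (x y : A) :
  de_morgan_lattice A -> le x y -> le y x -> x = y.
Proof.
by case=> -[[mC _] _ _ _] _ _ xy yx; rewrite -[LHS]xy -[RHS]yx mC.
Qed.

Lemma le_meetl (A : algebra) (x y : A) :
  de_morgan_lattice A -> le (meet x y) x.
Proof.
move=> hA; have := le_refl x hA; case: hA => -[[mC _] [mA _] _ _] _ _.
by rewrite /le => xx; rewrite mC mA xx.
Qed.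

Lemma le_meetr (A : algebra) (x y : A) :
  de_morgan_lattice A -> le (meet x y) y.
Proof. by move=> hA; case: (hA) => -[[-> _] _ _ _] _ _; apply: le_meetl. Qed.

Lemma le_meet (A : algebra) (x y z : A) :
  de_morgan_lattice A -> le z x -> le z y -> le z (meet x y).
Proof. by case=> -[_ [mA _] _ _] _ _; move=> zx zy; rewrite /le mA zx. Qed.

Lemma le_joinl (A : algebra) (x y : A) :
  de_morgan_lattice A -> le x (join x y).
Proof. by case=> -[_ _ [mK _] _] _ _; apply: mK. Qed.

Lemma le_joinr (A : algebra) (x y : A) :
  de_morgan_lattice A -> le y (join x y).
Proof. by case=> -[[_ jC] _ [mK _] _] _ _; rewrite /le jC; apply: mK. Qed.

Lemma le_join (A : algebra) (x y z : A) :
  de_morgan_lattice A -> le x z -> le y z -> le (join x y) z.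
Proof. by case=> -[_ _ _ D] _ _; rewrite /le D => -> ->. Qed.

Lemma neg_join (A : algebra) (x y : A) :
  de_morgan_lattice A -> neg (join x y) = meet (neg x) (neg y).
Proof.
by case=> _ nK nM; rewrite -[RHS]nK nM !nK.
Qed.

Definition point (A : algebra) (h : A -> bool) : Prop :=
  {morph h : x y / meet x y >-> x && y} /\
  {morph h : x y / join x y >-> x || y}.

Lemma point_le (A : algebra) (h : A -> bool) (x y : A) :
  point h -> le x y -> h x -> h y.
Proof. by case=> hM _ <-; rewrite hM => /andP[]. Qed.

Lemma point_dual (A : algebra) (h : A -> bool) :
  de_morgan_lattice A -> point h -> point (fun x => ~~ h (neg x)).
Proof.
move=> hA [hM hJ]; split=> x y.
  by case: (hA) => _ _ ->; rewrite hJ negb_or.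
by rewrite neg_join // hM negb_and.
Qed.

Definition is_filter (A : algebra) (F : A -> Prop) : Prop :=
  (forall x y, F x -> F y -> F (meet x y)) /\
  (forall x y, le x y -> F x -> F y).

Definition is_ideal (A : algebra) (I : A -> Prop) : Prop :=
  (forall x y, I x -> I y -> I (join x y)) /\
  (forall x y, le x y -> I y -> I x).

(** Zorn's lemma gives a filter maximal among those containing [F] and avoiding [I]; distributivity
    makes it prime. *)
Lemma prime_filter (A : algebra) (F I : A -> Prop) :
    de_morgan_lattice A -> is_filter F -> is_ideal I -> (exists x, F x) ->
    (forall x, F x -> ~ I x) ->
  exists2 h, point h & (forall x, F x -> h x) /\ (forall x, I x -> ~~ h x).
Proof.
move=> hA Ffil [IJ Id] [x0 Fx0] FI.
(* The empty set must be allowed: it is the union of the empty chain. *)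
pose P (X : set A) := [/\ is_filter X, (forall x, X x -> ~ I x)
  & forall x, X x -> forall y, F y -> X y].
have [|M [[[MM Mu] MI MF] Mmax]] := @Zorn_bigcup A P.
  move=> C CP Ctot; split; first split.
  - move=> x y [X CX Xx] [Y CY Yy].
    case: (Ctot _ _ CX CY) => XY.
      by exists Y => //; case: (CP _ CY) => -[H _] _ _; apply: H => //; apply: XY.
    by exists X => //; case: (CP _ CX) => -[H _] _ _; apply: H => //; apply: XY.
  - move=> x y xy [X CX Xx]; exists X => //.
    by case: (CP _ CX) => -[_ H] _ _; apply: H Xx.
  - by move=> x [X CX Xx]; case: (CP _ CX) => _ H _; apply: H.
  - move=> x [X CX Xx] y Fy; exists X => //.
    by case: (CP _ CX) => _ _ H; apply: H Xx _ Fy.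
(* Were some [y] of [F] missing from [M], then [M] would be empty by [MF], and [F] itself a strictly
   larger candidate. *)
have FM y : F y -> M y.
  move=> Fy; apply: contrapT => nMy; apply: (Mmax F); last by split.
  split=> [x Mx|H]; last exact/nMy/H.
  by case: nMy; apply: MF Mx _ Fy.
have Mext a : ~ M a -> exists2 m, M m & I (meet m a).
  move=> nMa; apply: contrapT => nI.
  apply: (Mmax (fun y => exists2 m, M m & le (meet m a) y)).
    split=> [x Mx|H]; first by exists x => //; apply: le_meetl.
    by apply: nMa; apply: H; exists x0; [exact: FM|exact: le_meetr].
  split; first split.
  - move=> x y [m Mm mx] [n Mn ny]; exists (meet m n); first exact: MM.
    apply: le_meet => //.
      apply: le_trans mx => //; apply: le_meet => //; last exact: le_meetr.
      by apply: (@le_trans _ _ (meet m n)) => //; apply: le_meetl.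
    apply: le_trans ny => //; apply: le_meet => //; last exact: le_meetr.
    by apply: (@le_trans _ _ (meet m n)) => //; [apply: le_meetl|apply: le_meetr].
  - by move=> x y xy [m Mm mx]; exists m => //; apply: le_trans xy.
  - by move=> x [m Mm mx] Ix; apply: nI; exists m => //; apply: Id Ix.
  - move=> x _ y Fy; exists y; [exact: FM|exact: le_meetl].
exists (fun x => `[< M x >]); last first.
  by split=> x H; [apply/asboolP/FM|apply/asboolP => /MI].
split=> x y; apply/idP/idP.
- move=> /asboolP Mxy; apply/andP; split; apply/asboolP.
    by apply: Mu Mxy; apply: le_meetl.
  by apply: Mu Mxy; apply: le_meetr.
- by move=> /andP[/asboolP ? /asboolP ?]; apply/asboolP/MM.
- move=> /asboolP Mxy; apply/orP.
  have [Mx|/Mext[m Mm Im]] := pselect (M x); first by left; apply/asboolP.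
  have [My|/Mext[n Mn In]] := pselect (M y); first by right; apply/asboolP.
  (* By distributivity this element of [M] lies below [join (meet m x) (meet n y)], which is in
     [I]. *)
  have := MM _ _ Mxy (MM _ _ Mm Mn); case/MI.
  apply: Id (IJ _ _ Im In).
  case: (hA) => -[_ _ _ ->] _ _; apply: le_join => //.
    apply: le_trans (le_joinl _ _ hA) => //; apply: le_meet => //; last exact: le_meetl.
    apply: (@le_trans _ _ (meet m n)) => //; [exact: le_meetr|exact: le_meetl].
  apply: le_trans (le_joinr _ _ hA) => //; apply: le_meet => //; last exact: le_meetl.
  apply: (@le_trans _ _ (meet m n)) => //; exact: le_meetr.
- case/orP=> /asboolP H; apply/asboolP; apply: Mu H; first exact: le_joinl.
  exact: le_joinr.
Qed.

(** Otherwise a prime filter separates the up-set of [x] from the down-set of [y]. Lattice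
    inequalities thus reduce to truth tables. *)
Lemma le_by_points (A : algebra) (x y : A) : de_morgan_lattice A ->
  (forall h, point h -> h x -> h y) -> le x y.
Proof.
move=> hA H; apply: contrapT => nxy.
have [|||z xz zy|h hp [hx hy]] :=
  @prime_filter A (fun z => le x z) (fun z => le z y) hA.
- by split=> [? ?|? ? ab xa]; [exact: le_meet|apply: le_trans ab].
- by split=> [? ?|? ? ab xa]; [exact: le_join|apply: le_trans xa].
- by exists x; apply: le_refl.
- by apply: nxy; apply: le_trans zy.
- have /negP[] := hy y (le_refl y hA).
  by apply: H => //; apply: hx; apply: le_refl.
Qed.

Lemma eq_point (A : algebra) (x y : A) : de_morgan_lattice A ->
  (forall h, point h -> h x = h y) -> x = y.
Proof.
by move=> hA H; apply: le_anti => //; apply: le_by_points => // h /H ->.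
Qed.

(* The disjointness of the ideal [I] below and its dual filter is where a fixed
   point would come from: if [y] and [neg y] both lie in [I], then so does
   [p = join y (neg y)], and [neg p <= p] turns some small [u] into [neg u]. *)
Lemma boolean_point (A : algebra) :
    de_morgan_lattice A -> (forall x : A, x <> neg x) ->
  exists2 h : A -> bool, point h & forall x, h (neg x) = ~~ h x.
Proof.
move=> hA nofix; case: (hA) => _ nK nM; have nJ x y := @neg_join A x y hA.
pose small (u : A) := le u (neg u).
(* A Boolean point is false on a small [u'], hence on every [y] with [le (meet y (neg u')) u']: [I]
   consists of such forced zeros. Quantifying over all [u] lets two witnesses be chained, which
   closes [I] under joins. *)
pose I y := forall u, small u ->
  exists u', [/\ small u', le u u' & le (meet y (neg u')) u'].
have small_meet x : small (meet x (neg x)).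
  by apply: le_by_points => // h [hM hJ]; rewrite nM nK hJ hM => /andP[-> ->].
have Ismall w : small w -> I w.
  (* [join u w] need not be small; cutting [w] down by [neg u] keeps the join small. *)
  move=> sw u su; exists (join u (meet w (neg u))); split.
  - apply: le_by_points => // h hp; have [hM hJ] := hp.
    have := point_le hp su; have := point_le hp sw.
    rewrite !(nJ, nM, nK, hM, hJ).
    by case: (h u) (h w) (h (neg u)) (h (neg w)) => [] [] [] [] // [].
  - exact: le_joinl.
  - apply: le_by_points => // h hp; have [hM hJ] := hp.
    rewrite !(nJ, nM, nK, hM, hJ).
    by case: (h u) (h w) (h (neg u)) (h (neg w)) => [] [] [] [] // [].
have Id x y : le x y -> I y -> I x.
  move=> xy Iy u /Iy[v [sv uv yv]]; exists v; split=> //.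
  apply: le_by_points => // h hp; have := point_le hp yv; have := point_le hp xy.
  case: hp => hM _; rewrite !hM => H1 H2 /andP[/H1 hy hv]; apply: H2.
  by rewrite hy.
have IJ x y : I x -> I y -> I (join x y).
  move=> Ix Iy u /Ix[v [sv uv xv]]; case/Iy: (sv) => w [sw vw yw].
  exists w; split=> //; first exact: le_trans vw.
  apply: le_by_points => // h hp.
  have := point_le hp xv; have := point_le hp yw; have := point_le hp vw.
  have H1 : h (neg w) -> h (neg v).
    apply: contraTT => hv; apply: (point_le (point_dual hA hp) vw).
    exact: hv.
  case: hp => hM hJ; rewrite !(hM, hJ).
  by case: (h x) (h y) (h v) (h w) (h (neg w)) (h (neg v)) H1
    => [] [] [] [] [] [] //= /(_ isT) //; auto.
have I_neg x : I x -> ~ I (neg x).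
  move=> Ix Inx; have Ip := IJ _ _ Ix Inx.
  have [u [su _ pu]] := Ip _ (small_meet x).
  apply: (nofix u); apply: le_anti => //; apply: le_by_points => // h hp.
  have := point_le hp pu; have := point_le (point_dual hA hp) pu.
  case: hp => hM hJ; rewrite /= !(nM, nJ, nK, hM, hJ).
  by case: (h x) (h (neg x)) (h u) (h (neg u)) => [] [] [] [] //= ? ?; auto.
have [||||h hp [hF hI]] := @prime_filter A (fun x => I (neg x)) I hA.
- split=> x y; first by rewrite nM; exact: IJ.
  move=> xy; apply: Id; apply: le_by_points => // h hp.
  by apply: contraTT; apply: (point_le (point_dual hA hp) xy).
- by split.
- case: (carrier_nonempty A) => x; exists (neg (meet x (neg x))).
  by rewrite nK; apply: Ismall.
- by move=> x Inx Ix; apply: I_neg Inx.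
(* [meet x (neg x)] is in [I] and its negation in the filter, so exactly one of [x] and [neg x] is
   true at [h]. *)
exists h => // x; have Ix := Ismall _ (small_meet x).
have := hI _ Ix; have := hF (neg (meet x (neg x))).
case: hp => hM hJ; rewrite nK nM nK hJ hM => /(_ Ix).
by case: (h x) (h (neg x)) => [] [].
Qed.

(** * Homomorphisms and the free De Morgan lattice *)

Definition hom (A B : algebra) (f : A -> B) : Prop :=
  [/\ {morph f : x y / meet x y}, {morph f : x y / join x y}
    & {morph f : x / neg x}].

Lemma hom_eval (A B : algebra) (f : A -> B) (v : nat -> A) (t : term) :
  hom f -> f (eval v t) = eval (f \o v) t.
Proof.
case=> fM fJ fN; elim: t => [n|s IHs t IHt|s IHs t IHt|s IHs] //=.
- by rewrite fM IHs IHt.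
- by rewrite fJ IHs IHt.
- by rewrite fN IHs.
Qed.

Notation free := (free_algebra de_morgan_lattice).

Definition free_repr (x : free) : term :=
  repr (x : {eq_quot (valid_in_rel de_morgan_lattice)}).

Definition lift (D : algebra) (w : nat -> D) (x : free) : D :=
  eval w (free_repr x).

Definition gen (i : nat) : free :=
  \pi_{eq_quot (valid_in_rel de_morgan_lattice)} (Var i).

Lemma lift_pi (D : algebra) (w : nat -> D) (t : term) : de_morgan_lattice D ->
  lift w (\pi_{eq_quot (valid_in_rel de_morgan_lattice)} t : free) = eval w t.
Proof.
move=> hD; rewrite /lift /free_repr; case: piP => s /eqmodP /asboolP H.
by rewrite (H D hD).
Qed.

Lemma lift_hom (D : algebra) (w : nat -> D) :
  de_morgan_lattice D -> hom (lift w).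
Proof.
move=> hD; split=> [x y|x y|x].
- exact: (lift_pi w (Meet (free_repr x) (free_repr y)) hD).
- exact: (lift_pi w (Join (free_repr x) (free_repr y)) hD).
- exact: (lift_pi w (Neg (free_repr x)) hD).
Qed.

Lemma lift_gen (D : algebra) (w : nat -> D) (i : nat) :
  de_morgan_lattice D -> lift w (gen i) = w i.
Proof. exact: lift_pi. Qed.

Lemma free_ext (x y : free) :
  (forall D, de_morgan_lattice D -> forall w : nat -> D, lift w x = lift w y) ->
  x = y.
Proof.
move=> H.
rewrite -[x](@reprK _ {eq_quot (valid_in_rel de_morgan_lattice)}).
rewrite -[y](@reprK _ {eq_quot (valid_in_rel de_morgan_lattice)}).
by apply/eqmodP/asboolP.
Qed.

(** Each axiom is checked after every [lift] into a De Morgan lattice, where it holds; these lifts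
    jointly separate elements. *)
Lemma free_de_morgan : de_morgan_lattice free.
Proof.
have ext (x y : free) :
  (forall (D : algebra) (w : nat -> D), de_morgan_lattice D -> hom (lift w) ->
    lift w x = lift w y) -> x = y.
  by move=> H; apply: free_ext => D hD w; apply: H => //; apply: lift_hom.
split; first split; first split; try (split; last 1 first); move=> *;
  apply: ext => D w [[[mC jC] [mA jA] [mK jK] mD] nK nM] [hM hJ hN];
  rewrite ?(hM, hJ, hN) //.
Qed.

Definition bool_algebra : algebra := Algebra andb orb negb (inhabits true).

Lemma bool_de_morgan : de_morgan_lattice bool_algebra.
Proof. by do 3?split; do ?case. Qed.

(* The pair (p, q) records the truth values of an element and of its negation. *)
Definition four : algebra :=
  @Algebra (bool * bool) (fun x y => (x.1 && y.1, x.2 || y.2))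
    (fun x y => (x.1 || y.1, x.2 && y.2)) (fun x => (x.2, x.1))
    (inhabits (true, true)).

Lemma four_de_morgan : de_morgan_lattice four.
Proof.
by split; first split; first split; try split; repeat (case; try case).
Qed.

Lemma free_no_fixpoint (x : free) : x <> neg x.
Proof.
have [_ _ hN] := @lift_hom bool_algebra (fun=> true) bool_de_morgan.
move=> /(congr1 (@lift bool_algebra (fun=> true))); rewrite hN /=.
by case: (lift _ x).
Qed.

(** * An antichain of points of the free algebra and the homomorphism built on it *)

Lemma point_foldr_meet (A : algebra) (c : A -> bool) (x : A) (s : seq A) :
  point c -> c (foldr (@meet A) x s) = c x && all c s.
Proof.
by case=> cM _; elim: s => [|y s IH] /=; rewrite ?andbT // cM IH andbCA.
Qed.

Lemma point_foldr_join (A : algebra) (c : A -> bool) (x : A) (s : seq A) :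
  point c -> c (foldr (@join A) x s) = c x || has c s.
Proof.
by case=> _ cJ; elim: s => [|y s IH] /=; rewrite ?orbF // cJ IH orbCA.
Qed.

(* When [mu] and [nu] are the truth values at a point of the vertices and of
   the covertices, this is the truth value of [mix] at that point: [H e] at
   the e-th vertex of the cube, true above some vertex, false below some vertex,
   and [p] elsewhere. *)
Definition blend (E : finType) (mu nu : pred E) (p : bool) (H : pred E) : bool :=
  if p then [forall e, nu e || (if H e then mu e else nu e)]
  else [exists e, mu e && (if H e then mu e else nu e)].

Lemma blend_at (E : finType) (mu nu : pred E) (e : E) (p : bool) (H : pred E) :
    (forall e e', e != e' -> mu e -> nu e') -> mu e -> ~~ nu e ->
  blend mu nu p H = H e.
Proof.
move=> munu me ne; rewrite /blend; case: p.
  apply/forallP/idP => [/(_ e)|He e']; first by rewrite (negPf ne); case: (H e).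
  have [<-|/munu/(_ me) ->//] := eqVneq e e'.
  by rewrite He me orbT.
apply/existsP/idP => [[e' /andP[me']]|He]; last by exists e; rewrite He me.
have [->|/munu/(_ me')] := eqVneq e' e; last by rewrite (negPf ne).
by case: (H e) => //; rewrite (negPf ne).
Qed.

(** The cases are a point at a vertex, above one, below one, or apart from all. In each, the blend
    is a projection or a constant in [(p, H)], hence respects meets and joins. *)
Lemma blendP (E : finType) (mu nu : pred E) (e0 : E) :
    (forall e e', e != e' -> mu e -> nu e') ->
  [\/ exists e, forall p H, blend mu nu p H = H e,
      forall p H, blend mu nu p H = true,
      forall p H, blend mu nu p H = false
    | forall p H, blend mu nu p H = p].
Proof.
move=> munu.
have [/existsP[e /andP[me ne]]|] := boolP [exists e, mu e && ~~ nu e].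
  by constructor 1; exists e => p H; apply: blend_at.
rewrite negb_exists => /forallP mn.
have {}mn e : mu e -> nu e by move=> me; have := mn e; rewrite me negbK.
have E1 p H : blend mu nu p H = if p then [forall e, nu e] else [exists e, mu e].
  rewrite /blend; case: p.
    apply: eq_forallb => e; have := mn e.
    by case: (H e) (mu e) (nu e) => [] [] [] // /(_ isT).
  apply: eq_existsb => e; have := mn e.
  by case: (H e) (mu e) (nu e) => [] [] [] // /(_ isT).
have [/existsP[e me]|nmu] := boolP [exists e, mu e].
  constructor 2 => p H; rewrite E1; case: p; last by apply/existsP; exists e.
  apply/forallP => e'; have [<-|/munu] := eqVneq e e'; first exact: mn.
  exact.
have [nu1|nnu] := boolP [forall e, nu e].
  by constructor 4 => p H; rewrite E1 nu1 (negPf nmu); case: p.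
by constructor 3 => p H; rewrite E1 (negPf nnu) (negPf nmu); case: p.
Qed.

Lemma blend_dual (E : finType) (g : E -> E) (mu nu : pred E) (p : bool)
    (H : pred E) : involutive g ->
  ~~ blend (fun e => ~~ nu (g e)) (fun e => ~~ mu (g e)) p H
    = blend mu nu (~~ p) (fun e => ~~ H (g e)).
Proof.
move=> gK; rewrite /blend; case: p => /=.
  rewrite negb_forall; apply/existsP/existsP => -[e He]; exists (g e);
    move: He; rewrite ?gK; case: (H _) (mu _) (nu _) => [] [] [] //.
rewrite negb_exists; apply/forallP/forallP => He e; have := He (g e);
  rewrite ?gK; case: (H _) (mu _) (nu _) => [] [] [] //.
Qed.

Definition flip (K : finType) (e : K * bool) : K * bool := (e.1, ~~ e.2).

Lemma flipK (K : finType) : involutive (@flip K).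
Proof. by case=> k b; rewrite /flip negbK. Qed.

(* The up-set of a point of the cube of assignments, one literal pair per index
   in [K * bool]; these points form an antichain, [covertex e] is true exactly at
   the points that are not below the e-th one, and negation acts by [flip]. *)
Definition vertex (K : finType) (e : K * bool) : free :=
  foldr (@meet free) (meet (gen (choice.pickle e)) (neg (gen (choice.pickle e))))
    [seq gen (choice.pickle e') | e' <- enum {: K * bool} & e'.1 != e.1].

Definition covertex (K : finType) (e : K * bool) : free :=
  neg (vertex (flip e)).

(** The generator of [flip e'] is a conjunct of [vertex e] and a disjunct of [covertex e']. *)
Lemma vertex_covertex (K : finType) (c : free -> bool) (e e' : K * bool) :
  point c -> e != e' -> c (vertex e) -> c (covertex e').
Proof.
move=> hc ee'; have hd := point_dual free_de_morgan hc.
rewrite -[c (covertex e')]negbK (point_foldr_meet _ _ hd).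
rewrite (point_foldr_meet _ _ hc); case: (hc) => cM _; case: (hd) => dM _.
rewrite cM dM; case: free_de_morgan => _ -> _.
move=> /andP[/andP[ce _] /allP call]; rewrite negb_and negb_and.
apply/orP; left; apply/orP; right; rewrite !negbK.
have [E|ne] := eqVneq e'.1 e.1; last first.
  by apply: call; apply: map_f; rewrite mem_filter mem_enum andbT.
suff -> : flip e' = e by [].
case: e e' ee' E {ce call} => [k b] [k' b'] /= ee' E; rewrite /flip /= E.
by move: ee'; rewrite -E xpair_eqE eqxx /=; case: b b' => [] [].
Qed.

(** First coordinates of a lift to [four] form a point. Here [w] makes all indexed generators true
    but that of [flip e], and all their negations false but that of [e]: half of the literals hold,
    hence the middle layer. *)
Lemma vertex_point (K : finType) (e : K * bool) :
  exists2 c : free -> bool, point c & c (vertex e) && ~~ c (covertex e).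
Proof.
pose w i : four := if choice.unpickle i is Some e' then
  (e' != flip e, e' == e) else (true, true).
have hw : hom (lift w) := lift_hom w four_de_morgan.
pose c x := (lift w x).1.
have hc : point c.
  by case: hw => hM hJ _; split=> x y; rewrite /c ?hM ?hJ.
have cg e' : c (gen (choice.pickle e')) = (e' != flip e).
  by rewrite /c (lift_gen w _ four_de_morgan) /w choice.pickleK.
have cng e' : c (neg (gen (choice.pickle e'))) = (e' == e).
  case: hw => _ _ hN.
  by rewrite /c hN (lift_gen w _ four_de_morgan) /w choice.pickleK.
have fe : e != flip e by case: (e) => k []; rewrite xpair_eqE andbF.
exists c => //; have hd := point_dual free_de_morgan hc; apply/andP; split.
  rewrite (point_foldr_meet _ _ hc); case: (hc) => -> _.
  rewrite cg cng eqxx fe; apply/allP => _ /mapP[e' + ->].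
  by rewrite mem_filter => /andP[ne _]; rewrite cg; apply: contraNneq ne => ->.
rewrite (point_foldr_meet _ _ hd) /=; case: (hd) => -> _.
case: free_de_morgan => _ nK _; rewrite nK cg cng eqxx eq_sym fe.
apply/allP => _ /mapP[e' + ->]; rewrite mem_filter => /andP[ne _].
by rewrite cng; apply: contraNneq ne => ->.
Qed.

(** The second index closes the family [h] under the involution on points, which then acts as
    [flip]. *)
Definition joint_point (A : algebra) (K : finType) (h : K -> A -> bool) (a : A)
    (e : K * bool) : bool :=
  if e.2 then ~~ h e.1 (neg a) else h e.1 a.

(** The two normal forms of [blend], written in the free algebra. The language has no bounds to
    start the folds from, so they start from the term at [(k0, true)], which also occurs in the
    list. *)
Definition mix (A : algebra) (p0 : A -> bool) (K : finType) (k0 : K)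
    (h : K -> A -> bool) (a : A) : free :=
  let ball (e : K * bool) :=
    if joint_point h a e then vertex e else covertex e in
  let up e := join (covertex e) (ball e) in
  let down e := meet (vertex e) (ball e) in
  let es := enum {: K * bool} in
  if p0 a then foldr (@meet free) (up (k0, true)) (map up es)
  else foldr (@join free) (down (k0, true)) (map down es).

Lemma point_mix (A : algebra) (p0 : A -> bool) (K : finType) (k0 : K)
    (h : K -> A -> bool) (c : free -> bool) (a : A) : point c ->
  c (mix p0 k0 h a) = blend (c \o @vertex K) (c \o @covertex K) (p0 a)
    (joint_point h a).
Proof.
move=> hc; have [cM cJ] := hc; rewrite /mix /blend; case: (p0 a).
  rewrite (point_foldr_meet _ _ hc); apply/andP/forallP => [[_ /allP H] e|H].
    have := H _ (map_f _ (mem_enum _ e)).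
    by rewrite cJ (fun_if c).
  split; first by have := H (k0, true); rewrite cJ (fun_if c).
  by apply/allP => _ /mapP[e _ ->]; have := H e; rewrite cJ (fun_if c).
rewrite (point_foldr_join _ _ hc); apply/orP/existsP => [[H|/hasP[_ /mapP[e _ ->] H]]|[e H]].
- by exists (k0, true); move: H; rewrite cM (fun_if c).
- by exists e; move: H; rewrite cM (fun_if c).
- right; apply/hasP; eexists; first exact: (map_f _ (mem_enum _ e)).
  by rewrite cM (fun_if c).
Qed.

(** By [blendP], a point [c] of the free algebra composed with [mix] is a [joint_point], a constant
    or [p0], all of them points. For negation, [blend_dual] compares [c] with its dual. *)
Lemma mix_hom (A : algebra) (p0 : A -> bool) (K : finType) (k0 : K)
    (h : K -> A -> bool) : de_morgan_lattice A ->
    point p0 -> (forall x, p0 (neg x) = ~~ p0 x) -> (forall k, point (h k)) ->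
  hom (mix p0 k0 h).
Proof.
move=> hA hp pN hh.
have hj e : point (fun a => joint_point h a e).
  by rewrite /joint_point; case: e.2; [apply: point_dual|].
have mixP c : point c -> point (c \o mix p0 k0 h).
  move=> hc; pose mu e := c (@vertex K e); pose nu e := c (@covertex K e).
  have H e e' : e != e' -> mu e -> nu e' by apply: vertex_covertex.
  have E a : c (mix p0 k0 h a) = blend mu nu (p0 a) (joint_point h a).
    exact: point_mix.
  have [pM pJ] := hp.
  by split=> x y /=; rewrite !E; case: (blendP (k0, true) H) => [[e B]|B|B|B];
    rewrite !B //; case: (hj e).
split=> [x y|x y|x].
- apply: eq_point free_de_morgan _ => c hc; have [cM _] := hc.
  by have [fM _] := mixP c hc; rewrite cM; apply: fM.
- apply: eq_point free_de_morgan _ => c hc; have [_ cJ] := hc.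
  by have [_ fJ] := mixP c hc; rewrite cJ; apply: fJ.
apply: eq_point free_de_morgan _ => c hc.
have hd := point_dual free_de_morgan hc.
rewrite -[RHS]negbK (point_mix _ _ _ _ hd) point_mix // pN.
have -> : joint_point h (neg x) = fun e => ~~ joint_point h x (flip e).
  apply/funext => -[k b]; rewrite /joint_point /=; case: b => //=.
    by case: hA => _ -> _.
  by rewrite negbK.
have -> : (fun y => ~~ c (neg y)) \o @vertex K = fun e => ~~ c (covertex (flip e)).
  by apply/funext => e /=; rewrite /covertex flipK.
have -> : (fun y => ~~ c (neg y)) \o @covertex K = fun e => ~~ c (vertex (flip e)).
  apply/funext => e; have [_ nK _] := free_de_morgan.
  exact: (congr1 (fun y => ~~ c y) (nK _)).
by rewrite -(blend_dual _ _ _ _ (@flipK K)).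
Qed.

Lemma mix_separates (A : algebra) (p0 : A -> bool) (K : finType) (k0 k : K)
    (h : K -> A -> bool) (a b : A) :
  mix p0 k0 h a = mix p0 k0 h b -> h k a = h k b.
Proof.
move=> ab; have [c hc /andP[ce nce]] := vertex_point (k, false).
have E x : c (mix p0 k0 h x) = h k x.
  rewrite point_mix // (@blend_at _ _ _ (k, false)) //.
  by move=> e e'; apply: vertex_covertex.
by rewrite -!E ab.
Qed.

Lemma free_admissible (A : algebra) (c : clause) :
    de_morgan_lattice A -> (forall x : A, x <> neg x) ->
  satisfies free c -> satisfies A c.
Proof.
move=> hA nofix Fc v prem; apply: contrapT => nconc.
have [p0 hp pN] := boolean_point hA nofix.
(* [None] keeps the index type inhabited when the clause has no conclusions. *)
pose K : finType := option (conclusions c).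
have sep (k : K) : exists h : A -> bool, point h /\
    (if k is Some e then h (eval v (val e).1) != h (eval v (val e).2) else true).
  case: k => [e|]; last by exists p0.
  apply: contrapT => nh; apply: nconc; exists (val e); first exact: valP.
  apply: eq_point => // h hh; apply: contrapT => /eqP ne; apply: nh.
  by exists h.
have [h hh] := choice sep.
have fh : hom (mix p0 None h) by apply: mix_hom => // k; case: (hh k).
have [e ec] : exists2 e, e \in conclusions c & holds (mix p0 None h \o v) e.
  by apply: Fc => e /prem; rewrite /holds -!hom_eval // => ->.
rewrite /holds -!hom_eval // => /(mix_separates (Some [` ec])) E.
by case: (hh (Some [` ec])) => _ /=; rewrite E eqxx.
Qed.

(** * Axioms as clauses, and the two bases *)

Definition equation (s t : term) : clause := Clause fset0 [fset (s, t)].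

Lemma satisfies_equation (A : algebra) (s t : term) :
  satisfies A (equation s t) <-> forall v : nat -> A, eval v s = eval v t.
Proof.
split=> H v; last by exists (s, t); rewrite ?inE.
have [e|e] := H v; first by rewrite inE.
by rewrite inE => /eqP ->.
Qed.

Inductive de_morgan_axiom : clause -> Prop :=
  | meetC_axiom : de_morgan_axiom (equation
      (Meet (Var 0) (Var 1)) (Meet (Var 1) (Var 0)))
  | joinC_axiom : de_morgan_axiom (equation
      (Join (Var 0) (Var 1)) (Join (Var 1) (Var 0)))
  | meetA_axiom : de_morgan_axiom (equation
      (Meet (Var 0) (Meet (Var 1) (Var 2)))
      (Meet (Meet (Var 0) (Var 1)) (Var 2)))
  | joinA_axiom : de_morgan_axiom (equation
      (Join (Var 0) (Join (Var 1) (Var 2)))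
      (Join (Join (Var 0) (Var 1)) (Var 2)))
  | meetK_axiom : de_morgan_axiom (equation
      (Meet (Var 0) (Join (Var 0) (Var 1))) (Var 0))
  | joinK_axiom : de_morgan_axiom (equation
      (Join (Var 0) (Meet (Var 0) (Var 1))) (Var 0))
  | meetD_axiom : de_morgan_axiom (equation
      (Meet (Join (Var 0) (Var 1)) (Var 2))
      (Join (Meet (Var 0) (Var 2)) (Meet (Var 1) (Var 2))))
  | negK_axiom : de_morgan_axiom (equation
      (Neg (Neg (Var 0))) (Var 0))
  | negM_axiom : de_morgan_axiom (equation
      (Neg (Meet (Var 0) (Var 1)))
      (Join (Neg (Var 0)) (Neg (Var 1)))).

Lemma de_morgan_axiomP (A : algebra) :
  de_morgan_lattice A <-> forall c, de_morgan_axiom c -> satisfies A c.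
Proof.
split=> [[[[mC jC] [mA jA] [mK jK] mD] nK nM] c|H].
  by case; apply/satisfies_equation => v /=.
have ax s t (c : de_morgan_axiom (equation s t)) (x y z : A) :
    eval (nth x [:: x; y; z]) s = eval (nth x [:: x; y; z]) t.
  exact: (iffLR (satisfies_equation _ _ _) (H _ c)).
split; first split; first split; try split.
- by move=> x y; apply: (ax _ _ meetC_axiom x y x).
- by move=> x y; apply: (ax _ _ joinC_axiom x y x).
- by move=> x y z; apply: (ax _ _ meetA_axiom x y z).
- by move=> x y z; apply: (ax _ _ joinA_axiom x y z).
- by move=> x y; apply: (ax _ _ meetK_axiom x y x).
- by move=> x y; apply: (ax _ _ joinK_axiom x y x).
- by move=> x y z; apply: (ax _ _ meetD_axiom x y z).
- by move=> x; apply: (ax _ _ negK_axiom x x x).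
- by move=> x y; apply: (ax _ _ negM_axiom x y x).
Qed.

Lemma de_morgan_axiom_quasi_identity (c : clause) :
  de_morgan_axiom c -> quasi_identity c.
Proof. by case; rewrite /quasi_identity cardfs1. Qed.

Lemma no_fixpointP (A : algebra) :
  satisfies A (Clause [fset (Var 0, Neg (Var 0))] fset0) <->
  forall x : A, x <> neg x.
Proof.
split=> [H x E|H v /(_ (Var 0, Neg (Var 0)))].
  have [e|e] := H (fun=> x); last by rewrite inE.
  by rewrite inE => /eqP ->.
by rewrite inE eqxx => /(_ isT) /H.
Qed.

Lemma trivial_fixpointP (A : algebra) :
  satisfies A (Clause [fset (Var 0, Neg (Var 0))] [fset (Var 0, Var 1)]) <->
  forall x y : A, x = neg x -> x = y.
Proof.
split=> [H x y E|H v /(_ (Var 0, Neg (Var 0)))].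
  have [e|e] := H (nth y [:: x]); first by rewrite inE => /eqP ->.
  by rewrite inE => /eqP ->.
rewrite inE eqxx => /(_ isT) E; exists (Var 0, Var 1); first by rewrite inE.
exact: H.
Qed.

Theorem theorem30 :
  let x := Var 0 in
  let y := Var 1 in
  admissible_clause_basis de_morgan_lattice
    (eq (Clause [fset (x, Neg x)] fset0)) /\
  admissible_quasi_identity_basis de_morgan_lattice
    (eq (Clause [fset (x, Neg x)] [fset (x, y)])).
Proof.
move=> x y; split; last split=> [c <-|]; last 1 first.
- move=> A; split=> [HA|[hA /(_ _ erefl) /trivial_fixpointP triv]].
    (* The models of [L] form a quasivariety containing the free algebra, so [A] is one of them. *)
    pose L c := de_morgan_axiom c \/ Clause [fset (x, Neg x)] [fset (x, y)] = c.
    have : forall c, L c -> satisfies A c.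
      apply: (HA (fun B => forall c, L c -> satisfies B c)).
        exists L; split=> // c [/de_morgan_axiom_quasi_identity//|<-].
        by rewrite /quasi_identity cardfs1.
      move=> _ <- c [|<-]; first by move: c; apply/de_morgan_axiomP/free_de_morgan.
      by apply/trivial_fixpointP => z t /free_no_fixpoint.
    move=> H; split=> [|c Lc]; last by apply: H; right.
    by apply/de_morgan_axiomP => c ax; apply: H; left.
  move=> C [L [Lq LC]] CF; apply/LC => c Lc.
  have [[z zfix]|nofix] := pselect (exists z : A, z = neg z); last first.
    apply: free_admissible => //; last by move/LC: (CF _ erefl); apply.
    by move=> z zfix; apply: nofix; exists z.
  (* The fixed point [z] equals every element, so the single conclusion of [c] holds trivially. *)
  move=> v _; have /eqP/cardfs1P[e ->] := Lq c Lc.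
  exists e; first by rewrite inE.
  by rewrite /holds -(triv z (eval v e.1)) // -(triv z (eval v e.2)).
- move=> A; split=> [HA|[hA /(_ _ erefl) /no_fixpointP nofix]].
    pose L c := de_morgan_axiom c \/ Clause [fset (x, Neg x)] fset0 = c.
    have : forall c, L c -> satisfies A c.
      apply: (HA (fun B => forall c, L c -> satisfies B c)); first by exists L.
      move=> _ <- c [|<-]; first by move: c; apply/de_morgan_axiomP/free_de_morgan.
      by apply/no_fixpointP/free_no_fixpoint.
    move=> H; split=> [|c Lc]; last by apply: H; right.
    by apply/de_morgan_axiomP => c ax; apply: H; left.
  move=> C [L LC] CF; apply/LC => c Lc.
  by apply: free_admissible => //; move/LC: (CF _ erefl); apply.
- by rewrite /quasi_identity cardfs1.
Qed.
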